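(* Let $m\ge3$ and let $\Omega\subset\mathbb{S}^m_+$ be an open domain with $\partial\Omega=\mathcal{V}_1\cup\mathcal{V}_2$, $\mathcal{V}_1\cap\mathcal{V}_2=\emptyset$, where $\mathcal{V}_1$ is a compact (not necessarily connected) hypersurface of $\mathbb{S}^m$ containing $\partial\mathbb{S}^m_+$ and $\mathcal{V}_2$ is a finite union of disjoint compact submanifolds of $\mathbb{S}^m$ (possibly points). Let $\rho\in C^{2,\alpha}(\Omega\cup\mathcal{V}_1)$, $g=e^{2\rho}g_0$, with $h(g)=c$ on $\partial\mathbb{S}^m_+$ for a constant $c\in\mathbb{R}$, and assume $\lim_{x\to q}\big(e^{2\rho(x)}+|\nabla\rho(x)|^2\big)=+\infty$ for all $q\in\mathcal{V}_2$. Set $\mathcal{V}_1'=\mathcal{V}_1\setminus\partial\mathbb{S}^m_+$. Then there exists $t_0\ge0$ such that for every $t>t_0$, $\phi_t(\Omega\cup\mathcal{V}_1')$ is contained in the half-space $\{y\in\mathbb{H}^{m+1}:\langle\!\langle y,(0,e_{m+1})\rangle\!\rangle\ge -e^{-t}c\}$, i.e. the side of the equidistant hypersurface $E(-e^{-t}c)$ whose ideal boundary contains the north pole ${\bf n}$.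
   Context: $\mathbb{S}^m\subset\mathbb{R}^{m+1}$ is the unit sphere with round metric $g_0$; $\nabla,|\cdot|$ w.r.t. $g_0$; ${\bf n}=e_{m+1}$ is the north pole, $\mathbb{S}^m_+=\{x\in\mathbb{S}^m:x_{m+1}>0\}$, $\partial\mathbb{S}^m_+=\{x_{m+1}=0\}$. $\mathbb{L}^{m+2}$ is $\mathbb{R}^{m+2}$ with $\langle\!\langle x,y\rangle\!\rangle=-x_0y_0+\sum_{i=1}^{m+1}x_iy_i$, $\mathbb{H}^{m+1}=\{x:\langle\!\langle x,x\rangle\!\rangle=-1,x_0>0\}$, and $E(s)=\{y\in\mathbb{H}^{m+1}:\langle\!\langle y,(0,e_{m+1})\rangle\!\rangle=s\}$. For $\rho\in C^1$ the associated map is $\phi^\rho(x)=\frac{e^{\rho}}{2}\big(1+e^{-2\rho}(1+|\nabla\rho|^2)\big)(1,x)+e^{-\rho}(0,-x+\nabla\rho)$, and $\phi_t:=\phi^{\rho+t}$ (parallel flow). The mean curvature of $\partial\mathbb{S}^m_+$ w.r.t. $g=e^{2\rho}g_0$ and the unit normal $e^{-\rho}e_{m+1}$ pointing into $\mathbb{S}^m_+$ is $h(g)=-e^{-\rho}\langle\nabla\rho,e_{m+1}\rangle$ (normalized mean curvature; this is the case $r=\pi/2$, $p={\bf n}$ of $h(g)=e^{-\rho}(\cot r-\partial\rho/\partial\nu)$). *)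

(* Defs.v *)
From Stdlib Require Import Reals.
From mathcomp Require Import all_boot.
Open Scope R_scope.

(* A point of R^{m+1}; coordinate ord_max (= index m) is x_{m+1}. *)
Definition Point (m : nat) := 'I_m.+1 -> R.

Definition dot {m} (x y : Point m) : R := \big[Rplus/0]_(i < m.+1) (x i * y i).
Definition norm {m} (x : Point m) : R := sqrt (dot x x).
Definition pdist {m} (x y : Point m) : R := norm (fun i => x i - y i).

Definition basis {m} (i : 'I_m.+1) : Point m := fun j => if j == i then 1 else 0.
Definition north (m : nat) : Point m := basis ord_max.

Definition in_sphere {m} (x : Point m) : Prop := dot x x = 1.
Definition upper_hemisphere {m} (x : Point m) : Prop := in_sphere x /\ x ord_max > 0.
Definition equator {m} (x : Point m) : Prop := in_sphere x /\ x ord_max = 0.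

Definition open_set {m} (U : Point m -> Prop) : Prop :=
  forall x, U x -> exists eps, eps > 0 /\ forall y, pdist y x < eps -> U y.

Definition sphere_open {m} (O : Point m -> Prop) : Prop :=
  forall x, O x -> in_sphere x /\
    exists eps, eps > 0 /\ forall y, in_sphere y -> pdist y x < eps -> O y.

Definition connected {m} (O : Point m -> Prop) : Prop :=
  ~ exists U W : Point m -> Prop, open_set U /\ open_set W /\
      (forall x, O x -> U x \/ W x) /\
      (exists x, O x /\ U x) /\ (exists x, O x /\ W x) /\
      (forall x, O x -> U x -> W x -> False).

Definition sphere_domain {m} (O : Point m -> Prop) : Prop :=
  sphere_open O /\ connected O /\ exists x, O x.

Definition sphere_boundary {m} (O : Point m -> Prop) (x : Point m) : Prop :=
  in_sphere x /\ forall eps, eps > 0 ->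
    (exists y, O y /\ pdist y x < eps) /\
    (exists y, in_sphere y /\ ~ O y /\ pdist y x < eps).

Definition compact_set {m} (K : Point m -> Prop) : Prop :=
  forall u : nat -> Point m, (forall n, K (u n)) ->
    exists phi : nat -> nat, (forall n, (phi n < phi (S n))%nat) /\
      exists l, K l /\ forall eps, eps > 0 ->
        exists N, forall n, (N <= n)%nat -> pdist (u (phi n)) l < eps.

Definition cont_on {m} (A : Point m -> Prop) (f : Point m -> R) : Prop :=
  forall x, A x -> forall eps, eps > 0 -> exists delta, delta > 0 /\
    forall y, A y -> pdist y x < delta -> Rabs (f y - f x) < eps.

Definition has_partial {m} (f : Point m -> R) (i : 'I_m.+1) (x : Point m) (l : R) : Prop :=
  derivable_pt_lim (fun s => f (fun j => x j + s * basis i j)) 0 l.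

Fixpoint Ck_on {m} (U : Point m -> Prop) (k : nat) (f : Point m -> R) : Prop :=
  match k with
  | O => cont_on U f
  | S k' => exists D : 'I_m.+1 -> Point m -> R,
      (forall x, U x -> forall i, has_partial f i x (D i x)) /\
      forall i, Ck_on U k' (D i)
  end.

Definition smooth_on {m} (U : Point m -> Prop) (f : Point m -> R) : Prop :=
  forall k, Ck_on U k f.

Definition submanifold {m} (k : nat) (S : Point m -> Prop) : Prop :=
  (k <= m.+1)%nat /\
  forall p, S p -> exists U : Point m -> Prop, open_set U /\ U p /\
    exists (F : 'I_(m.+1 - k) -> Point m -> R)
           (DF : 'I_(m.+1 - k) -> 'I_m.+1 -> Point m -> R),
      (forall j, smooth_on U (F j)) /\
      (forall x, U x -> forall j i, has_partial (F j) i x (DF j i x)) /\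
      (forall x, U x -> (S x <-> forall j, F j x = 0)) /\
      (forall x, U x -> S x -> forall a : 'I_(m.+1 - k) -> R,
         (forall i, \big[Rplus/0]_(j < m.+1 - k) (a j * DF j i x) = 0) ->
         forall j, a j = 0).

Definition compact_sphere_hypersurface {m} (V : Point m -> Prop) : Prop :=
  (forall x, V x -> in_sphere x) /\ compact_set V /\ submanifold m.-1 V.

Definition finite_union_compact_submanifolds {m} (V : Point m -> Prop) : Prop :=
  exists (n : nat) (Sj : nat -> Point m -> Prop) (dj : nat -> nat),
    (forall j, (j < n)%nat ->
       (forall x, Sj j x -> in_sphere x) /\ compact_set (Sj j) /\ submanifold (dj j) (Sj j)) /\
    (forall j k x, (j < n)%nat -> (k < n)%nat -> j <> k -> Sj j x -> Sj k x -> False) /\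
    (forall x, V x <-> exists j, (j < n)%nat /\ Sj j x).

Definition normalize {m} (y : Point m) : Point m := fun i => y i / norm y.
Definition cone {m} (A : Point m -> Prop) (y : Point m) : Prop :=
  norm y > 0 /\ A (normalize y).

(* rho in C^{2,alpha}(O u V) for O open in S^m, with G = first and H = second
   partial derivatives of the 0-homogeneous extension rho(y/|y|) on the cone over O,
   extended continuously (and locally alpha-Hoelder for H) to the cone over O u V.
   On the sphere, G(x) is the spherical gradient of rho. *)
Definition C2alpha {m} (O V : Point m -> Prop) (alpha : R) (rho : Point m -> R)
    (G : 'I_m.+1 -> Point m -> R) (H : 'I_m.+1 -> 'I_m.+1 -> Point m -> R) : Prop :=
  let A := fun x => O x \/ V x in
  0 < alpha < 1 /\
  (forall y, cone O y -> forall i, has_partial (fun z => rho (normalize z)) i y (G i y)) /\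
  (forall y, cone O y -> forall i j, has_partial (G i) j y (H i j y)) /\
  cont_on (cone A) (fun z => rho (normalize z)) /\
  (forall i, cont_on (cone A) (G i)) /\
  (forall i j, cont_on (cone A) (H i j)) /\
  (forall x, A x -> exists delta C, delta > 0 /\
     forall i j y z, cone A y -> cone A z -> pdist y x < delta -> pdist z x < delta ->
       Rabs (H i j y - H i j z) <= C * Rpower (pdist y z) alpha).

Definition LPoint (m : nat) := (R * Point m)%type.
Definition lorentz {m} (a b : LPoint m) : R := - (fst a * fst b) + dot (snd a) (snd b).
Definition in_hyperbolic {m} (y : LPoint m) : Prop := lorentz y y = -1 /\ fst y > 0.

(* phi^rho(x) where r = rho(x) and v = nabla rho(x) *)
Definition phi_map {m} (r : R) (v : Point m) (x : Point m) : LPoint m :=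
  let a := exp r / 2 * (1 + exp (-2 * r) * (1 + dot v v)) in
  (a, fun i => a * x i + exp (- r) * (- x i + v i)).

Definition vec_of {m} (G : 'I_m.+1 -> Point m -> R) (x : Point m) : Point m := fun i => G i x.

(* normalized mean curvature of the equator for g = e^{2 rho} g0 *)
Definition mean_curv_equator {m} (rho : Point m -> R) (G : 'I_m.+1 -> Point m -> R)
  (x : Point m) : R := - exp (- rho x) * dot (vec_of G x) (north m).

(* Main.v *)
Require Import Defs.
From HB Require Import structures.
From Stdlib Require Import Reals Lra Classical IndefiniteDescription
  FunctionalExtensionality.
From mathcomp Require Import all_boot.
Open Scope R_scope.

(* Write h = x_{m+1}, v = nabla rho(x). Multiplied by e^t, the claimed inequality reads
     h (e^{rho + 2t} + e^{-rho} (|v|^2 - 1)) / 2 + (e^{-rho} v_{m+1} + c) >= 0.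
   By compactness of the sphere it suffices to find, near each q, a threshold for t.
   Near q in V2 the term h (e^{2 rho} + |v|^2) dominates for all t > 0; near a point of
   Omega or V1 off the equator, rho and v are bounded and e^{2t} dominates. Near an
   equatorial q, V1 coincides with the equator and V2 stays away, so the meridian from x
   to the equator stays in Omega; since e^{-rho} v_{m+1} + c vanishes on the equator and
   rho is C^2 up to it, this term is O(h), and again e^{2t} dominates. *)

(** The obstacle is the equator: the growing term carries the factor h, so the remainder must vanish
    there to first order, while derivatives of rho exist only over Omega and merely extend
    continuously to V1. Hence the mean value theorem is applied away from the equatorial endpoint
    and passed to the limit. That the connecting meridians stay in Omega is not a hypothesis:
    another sheet of V1 could a priori touch the equator, which the rank condition on its two
    defining functions forbids, and V2 cannot approach a point of Omega or V1 because rho and its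
    gradient are bounded near it. Since [G] is the gradient of the 0-homogeneous extension,
    meridians can be replaced by vertical segments, along which [H ord_max ord_max] is the
    derivative of [G ord_max]. The same homogeneity gives the orthogonality of x and v that puts the
    image on the hyperboloid. As the set of admissible points is not closed, thresholds are attached
    to every point of the sphere, even where no inequality is claimed. *)

HB.instance Definition _ := Monoid.isComLaw.Build R 0 Rplus
  (fun x y z => esym (Rplus_assoc x y z)) Rplus_comm Rplus_0_l.

(** * Coordinate sums and Euclidean geometry *)

Lemma sum_scale n a (F : 'I_n -> R) :
  \big[Rplus/0]_(i < n) (a * F i) = a * \big[Rplus/0]_(i < n) F i.
Proof. elim/big_rec2: _ => [|i x y _ ->]; ring. Qed.

Lemma sum_ge0 n (F : 'I_n -> R) :
  (forall i, 0 <= F i) -> 0 <= \big[Rplus/0]_(i < n) F i.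
Proof.
move=> F0; elim/big_ind: _ => [|x y|i _]; [lra | lra | exact: F0].
Qed.

Lemma sum_le_const n (F : 'I_n -> R) d :
  (forall i, F i <= d) -> \big[Rplus/0]_(i < n) F i <= INR n * d.
Proof.
elim: n F => [|n IH] F Fd; first by rewrite big_ord0 /=; lra.
rewrite big_ord_recr S_INR.
have := IH (fun i => F (widen_ord (leqnSn n) i)) (fun i => Fd _).
have := Fd ord_max; rewrite /=; lra.
Qed.

Section Euclid.
Context {m : nat}.
Implicit Types x y z v w : Point m.

Lemma dotC x y : dot x y = dot y x.
Proof. by apply: eq_bigr => i _; rewrite Rmult_comm. Qed.

Lemma dot_lin a b x y z :
  dot (fun i => a * x i + b * y i) z = a * dot x z + b * dot y z.
Proof.
rewrite /dot -!sum_scale -big_split /=; apply: eq_bigr => i _; ring.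
Qed.

Lemma dot_self_lin a b x y :
  dot (fun i => a * x i + b * y i) (fun i => a * x i + b * y i)
  = a * a * dot x x + 2 * (a * b) * dot x y + b * b * dot y y.
Proof.
rewrite dot_lin (dotC x) (dotC y) !dot_lin (dotC y x); ring.
Qed.

Lemma dot_ge0 x : 0 <= dot x x.
Proof. by apply: sum_ge0 => i; apply: Rle_0_sqr. Qed.

Lemma sqr_coord_le x i : x i * x i <= dot x x.
Proof.
rewrite /dot (bigD1 i) //=.
set s := \big[_/_]_(_ | _) _.
have : 0 <= s by rewrite /s; elim/big_ind: _ => [|a b|j _];
  [lra | lra | exact: Rle_0_sqr].
lra.
Qed.

Lemma dot_basis v i : dot v (basis i) = v i.
Proof.
rewrite /dot (bigD1 i) //= big1 => [|j /negbTE ji]; rewrite /basis ?eqxx ?ji; ring.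
Qed.

Lemma sqr_dot_le x y : dot x y * dot x y <= dot x x * dot y y.
Proof.
have Y0 := dot_ge0 y.
have [Yp|Y] : 0 < dot y y \/ dot y y = 0 by lra.
- have := dot_ge0 (fun i => dot y y * x i + - dot x y * y i).
  rewrite dot_self_lin => h.
  have : 0 <= dot y y * (dot x x * dot y y - dot x y * dot x y) by lra.
  nra.
- have := dot_ge0 (fun i => dot x y * x i + (- (dot x x + 1) / 2) * y i).
  rewrite dot_self_lin Y; nra.
Qed.

Lemma norm_ge0 x : 0 <= norm x.
Proof. exact: sqrt_pos. Qed.

Lemma norm_sqr x : norm x * norm x = dot x x.
Proof. exact: sqrt_def (dot_ge0 x). Qed.

Lemma le_of_sqr a b : 0 <= b -> a * a <= b * b -> a <= b.
Proof. by move=> b0 h; case: (Rle_lt_dec a b) => // ?; nra. Qed.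

Lemma abs_le_of_sqr a b : 0 <= b -> a * a <= b * b -> Rabs a <= b.
Proof.
move=> b0 h; apply: Rabs_le.
by split; [suff: - a <= b by lra|]; apply: le_of_sqr => //; nra.
Qed.

Lemma abs_dot_le x y : Rabs (dot x y) <= norm x * norm y.
Proof.
have := norm_ge0 x; have := norm_ge0 y => ? ?.
apply: abs_le_of_sqr; first nra.
have := sqr_dot_le x y; rewrite -!norm_sqr; lra.
Qed.

Lemma abs_coord_le x i : Rabs (x i) <= norm x.
Proof.
by apply: abs_le_of_sqr (norm_ge0 x) _; rewrite norm_sqr; apply: sqr_coord_le.
Qed.

Lemma norm_lin_le a b x y :
  norm (fun i => a * x i + b * y i) <= Rabs a * norm x + Rabs b * norm y.
Proof.
have ? := norm_ge0 x; have ? := norm_ge0 y.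
have ? := Rabs_pos a; have ? := Rabs_pos b.
apply: le_of_sqr; first nra.
rewrite norm_sqr dot_self_lin -!norm_sqr.
have sq r : Rabs r * Rabs r = r * r by rewrite -Rabs_mult Rabs_right //; nra.
have := sq a; have := sq b => Ea Eb.
have h : a * b * dot x y <= Rabs a * Rabs b * (norm x * norm y).
  apply: Rle_trans (Rle_abs _) _; rewrite !Rabs_mult.
  by apply: Rmult_le_compat_l; [nra | apply: abs_dot_le].
nra.
Qed.

Lemma norm_scale a x : norm (fun i => a * x i) = Rabs a * norm x.
Proof.
have -> : (fun i => a * x i) = (fun i => a * x i + 0 * x i).
  by apply: functional_extensionality => i; ring.
rewrite /norm dot_self_lin.
have -> : a * a * dot x x + 2 * (a * 0) * dot x x + 0 * 0 * dot x x = Rsqr a * dot x x.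
  by rewrite /Rsqr; ring.
by rewrite sqrt_mult_alt ?sqrt_Rsqr_abs //; apply: Rle_0_sqr.
Qed.

Lemma norm_le_coord x d : (forall i, Rabs (x i) <= d) -> norm x <= INR m.+1 * d.
Proof.
move=> xd; have d0 : 0 <= d by have := xd ord0; have := Rabs_pos (x ord0); lra.
have m1 : 1 <= INR m.+1 by rewrite S_INR; have := pos_INR m; lra.
apply: le_of_sqr; first nra.
rewrite norm_sqr; apply: Rle_trans (_ : INR m.+1 * (d * d) <= _).
  apply: sum_le_const => i; have := xd i; have := Rabs_pos (x i) => ? ?.
  have -> : x i * x i = Rabs (x i) * Rabs (x i) by rewrite -Rabs_mult Rabs_right //; nra.
  nra.
nra.
Qed.

Lemma pdist_ge0 x y : 0 <= pdist x y.
Proof. exact: norm_ge0. Qed.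

Lemma pdistC x y : pdist x y = pdist y x.
Proof.
rewrite /pdist.
have -> : (fun i => x i - y i) = (fun i => -1 * (y i - x i)).
  by apply: functional_extensionality => i; ring.
by rewrite norm_scale Rabs_left; lra.
Qed.

Lemma pdist_triangle y x z : pdist x z <= pdist x y + pdist y z.
Proof.
rewrite /pdist.
have -> : (fun i => x i - z i) = (fun i => 1 * (x i - y i) + 1 * (y i - z i)).
  by apply: functional_extensionality => i; ring.
by apply: Rle_trans (norm_lin_le _ _ _ _) _; rewrite Rabs_R1; lra.
Qed.

Lemma pdistxx x : pdist x x = 0.
Proof.
apply: Rle_antisym; last exact: pdist_ge0.
have <- : INR m.+1 * 0 = 0 by ring.
by apply: norm_le_coord => i; rewrite Rminus_diag Rabs_R0; lra.
Qed.

Lemma abs_coord_sub_le x y i : Rabs (x i - y i) <= pdist x y.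
Proof. exact: (abs_coord_le (fun i => x i - y i)). Qed.

Lemma abs_norm_sub_le x y : Rabs (norm x - norm y) <= pdist x y.
Proof.
have h (a b : Point m) : norm a <= norm b + pdist a b.
  have -> : norm a = norm (fun i => 1 * b i + 1 * (a i - b i)).
    by congr norm; apply: functional_extensionality => i; ring.
  by apply: Rle_trans (norm_lin_le _ _ _ _) _; rewrite Rabs_R1 /pdist; lra.
by apply: Rabs_le; have := h x y; have := h y x; rewrite (pdistC y x); lra.
Qed.

Lemma norm_sphere x : in_sphere x -> norm x = 1.
Proof. by rewrite /norm => ->; rewrite sqrt_1. Qed.

Lemma sphere_norm x : norm x = 1 -> in_sphere x.
Proof. by rewrite /in_sphere -norm_sqr => ->; ring. Qed.

Lemma normalize_sphere x : in_sphere x -> normalize x = x.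
Proof.
move=> /norm_sphere x1; apply: functional_extensionality => i.
by rewrite /normalize x1; field.
Qed.

(* Also valid at the origin, since [/ 0 = 0]. *)
Lemma normalize_scale a x : 0 < a -> normalize (fun i => a * x i) = normalize x.
Proof.
move=> a0; apply: functional_extensionality => i.
rewrite /normalize norm_scale Rabs_right; last lra.
have [E|x0] : norm x = 0 \/ 0 < norm x by have := norm_ge0 x; lra.
  by rewrite E Rmult_0_r /Rdiv Rinv_0 !Rmult_0_r.
by field; lra.
Qed.

Lemma in_sphere_normalize x : 0 < norm x -> in_sphere (normalize x).
Proof.
move=> x0; apply: sphere_norm.
have -> : normalize x = (fun i => / norm x * x i).
  by apply: functional_extensionality => i; rewrite /normalize; field; lra.
have := Rinv_0_lt_compat _ x0 => ?.
by rewrite norm_scale Rabs_right; [field; lra | lra].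
Qed.

(** In x/|x| - y/|y| = (x - y)/|y| + ((|y| - |x|)/(|x||y|)) x both terms are at most |x - y|/|y|, so
    no lower bound on the norm of [x] enters. *)
Lemma normalize_lipschitz x y : 0 < norm x -> 0 < norm y ->
  pdist (normalize x) (normalize y) <= 2 * pdist x y / norm y.
Proof.
move=> x0 y0; rewrite {1}/pdist /normalize.
have -> : (fun i => x i / norm x - y i / norm y) =
  (fun i => / norm y * (x i - y i) + ((norm y - norm x) / (norm x * norm y)) * x i).
  by apply: functional_extensionality => i; field; lra.
apply: Rle_trans (norm_lin_le _ _ _ _) _.
have iy := Rinv_0_lt_compat _ y0.
rewrite (Rabs_right (/ norm y)); last lra.
rewrite /Rdiv Rabs_mult (Rabs_right (/ (_ * _))); last first.
  by apply: Rle_ge; apply: Rlt_le; apply: Rinv_0_lt_compat; nra.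
have -> : Rabs (norm y - norm x) * / (norm x * norm y) * norm x =
  Rabs (norm y - norm x) * / norm y by field; lra.
have := abs_norm_sub_le y x; rewrite (pdistC y x) -/(pdist x y) => ?.
nra.
Qed.

End Euclid.

(** * Partial derivatives, strict differentiability and secants *)

Lemma common_radius (T : finType) (P : T -> R -> Prop) :
  (forall i d d', d' <= d -> P i d -> P i d') ->
  (forall i, exists d, d > 0 /\ P i d) ->
  exists d, d > 0 /\ forall i, P i d.
Proof.
move=> mono ex.
suff [d [d0 Pd]] : exists d, d > 0 /\ forall i, i \in enum T -> P i d.
  by exists d; split => // i; apply: Pd; rewrite mem_enum.
elim: (enum T) => [|i s [d [d0 Pd]]]; first by exists 1; split; [lra|].
have [e [e0 Pe]] := ex i.
exists (Rmin d e); split; first exact: Rmin_pos.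
move=> j; rewrite in_cons => /orP [/eqP ->|/Pd Pj].
  by apply: mono Pe; apply: Rmin_r.
by apply: mono Pj; apply: Rmin_l.
Qed.

Definition shift {m} (x : Point m) (i : 'I_m.+1) (s : R) : Point m :=
  fun j => x j + s * basis i j.

Section Calculus.
Context {m : nat}.
Implicit Types (x y z q : Point m) (f : Point m -> R).

Lemma shift0 x i : shift x i 0 = x.
Proof. by apply: functional_extensionality => j; rewrite /shift; ring. Qed.

Lemma shiftD x i s t : shift (shift x i s) i t = shift x i (s + t).
Proof. by apply: functional_extensionality => j; rewrite /shift; ring. Qed.

Lemma shift_derivable f i x s l :
  has_partial f i (shift x i s) l -> derivable_pt_lim (fun s => f (shift x i s)) s l.
Proof.
move=> h eps eps0; have [d hd] := h eps eps0.
exists d => k k0 kd; have := hd k k0 kd.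
rewrite -/(shift (shift x i s) i (0 + k)) -/(shift (shift x i s) i 0) !shiftD.
by rewrite Rplus_0_l Rplus_0_r.
Qed.

Lemma has_partial_unique f i x a b : has_partial f i x a -> has_partial f i x b -> a = b.
Proof. exact: uniqueness_limite. Qed.

Lemma partial_mean_value f (D : Point m -> R) i x b :
  (forall s, Rmin 0 b <= s <= Rmax 0 b -> has_partial f i (shift x i s) (D (shift x i s))) ->
  exists s, Rmin 0 b <= s <= Rmax 0 b /\ f (shift x i b) - f x = D (shift x i s) * b.
Proof.
move=> h.
have hd s : Rmin 0 b <= s <= Rmax 0 b ->
  derivable_pt_lim (fun s => f (shift x i s)) s (D (shift x i s)).
  by move=> /h; apply: shift_derivable.
have [b0|[b0|b0]] := Rtotal_order b 0.
- have Em : Rmin 0 b = b by rewrite Rmin_right //; lra.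
  have EM : Rmax 0 b = 0 by rewrite Rmax_left //; lra.
  rewrite Em EM in hd *.
  have [s []] := MVT_cor2 (fun s => f (shift x i s)) (fun s => D (shift x i s)) b 0 b0 hd.
  by rewrite shift0 => E sb; exists s; split; lra.
- exists 0; rewrite b0 Rmin_left ?Rmax_left; try lra.
  by rewrite !shift0; split; [lra | ring].
- have Em : Rmin 0 b = 0 by rewrite Rmin_left //; lra.
  have EM : Rmax 0 b = b by rewrite Rmax_right //; lra.
  rewrite Em EM in hd *.
  have [s []] := MVT_cor2 (fun s => f (shift x i s)) (fun s => D (shift x i s)) 0 b b0 hd.
  by rewrite shift0 => E sb; exists s; split; lra.
Qed.

(* Change the coordinates of z into those of y one at a time: on each step the
   increment of f is a partial derivative at an intermediate point, all of whose
   coordinates lie between those of z and y. *)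
Lemma strictly_differentiable f (D : 'I_m.+1 -> Point m -> R) q d0 : d0 > 0 ->
  (forall y, pdist y q < d0 -> forall i, has_partial f i y (D i y)) ->
  (forall i eps, eps > 0 -> exists d, d > 0 /\
     forall y, pdist y q < d -> Rabs (D i y - D i q) < eps) ->
  forall eps, eps > 0 -> exists d, d > 0 /\ forall y z, pdist y q < d -> pdist z q < d ->
    Rabs (f y - f z - dot (fun i => y i - z i) (fun i => D i q)) <= eps * pdist y z.
Proof.
move=> d00 Df Dc eps eps0.
have m1 : 0 < INR m.+1 by apply: lt_0_INR; apply/ltP.
set e := eps / INR m.+1.
have e0 : e > 0 by apply: Rdiv_lt_0_compat.
have [d1 [d10 H1]] := common_radius _
  (fun i d => forall y, pdist y q < d -> Rabs (D i y - D i q) < e)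
  (fun i d d' dd' h y yd => h y (Rlt_le_trans _ _ _ yd dd')) (fun i => Dc i e e0).
exists (Rmin d0 d1 / 2); split; first by have := Rmin_pos _ _ d00 d10; lra.
move=> y z yq zq.
(* For each coordinate, the squared distance from [q j] to a number between [y j] and [z j] is at
   most the larger, hence the sum, of the squared distances to [y j] and [z j]. *)
have near w : (forall j, Rmin (y j) (z j) <= w j <= Rmax (y j) (z j)) ->
    pdist w q < d0 /\ pdist w q < d1.
  move=> hw.
  suff : pdist w q <= pdist y q + pdist z q.
    by have := Rmin_l d0 d1; have := Rmin_r d0 d1; lra.
  have ? := pdist_ge0 y q; have ? := pdist_ge0 z q.
  apply: le_of_sqr; first lra.
  apply: Rle_trans (_ : pdist y q * pdist y q + pdist z q * pdist z q <= _); last nra.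
  rewrite /pdist !norm_sqr /dot -big_split /=.
  elim/big_ind2: _ => [|a b a' b'|j _]; [lra | lra |].
  have := hw j; rewrite /Rmin /Rmax; case: Rle_dec => _ [? ?].
    have := Rle_0_sqr (y j - q j); have := Rle_0_sqr (z j - q j); rewrite /Rsqr.
    by case: (Rle_lt_dec (q j) (w j)) => ?; nra.
  have := Rle_0_sqr (y j - q j); have := Rle_0_sqr (z j - q j); rewrite /Rsqr.
  by case: (Rle_lt_dec (q j) (w j)) => ?; nra.
pose hyb k : Point m := fun j => if (j < k)%N then y j else z j.
have hybB k j : Rmin (y j) (z j) <= hyb k j <= Rmax (y j) (z j).
  by rewrite /hyb /Rmin /Rmax; case: Rle_dec; case: ifP => _; lra.
have step k : (k <= m.+1)%N ->
  Rabs (f (hyb k) - f z - dot (fun i => hyb k i - z i) (fun i => D i q))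
    <= INR k * (e * pdist y z).
  elim: k => [|k IH] km.
    have -> : hyb 0%N = z by apply: functional_extensionality.
    have -> : dot (fun i => z i - z i) (fun i => D i q) = 0.
      by apply: big1 => i _; ring.
    by rewrite !Rminus_diag Rabs_R0 /=; lra.
  pose i := Ordinal km.
  have hS : hyb k.+1 = shift (hyb k) i (y i - z i).
    apply: functional_extensionality => j; rewrite /hyb /shift /basis ltnS leq_eqVlt.
    case: (j =P i) => [->|ne] /=; first by rewrite eqxx ltnn /=; ring.
    have -> : (nat_of_ord j == k) = false by apply/eqP => E; apply: ne; apply: val_inj.
    by case: ifP => _ /=; ring.
  have nears s : Rmin 0 (y i - z i) <= s <= Rmax 0 (y i - z i) ->
      pdist (shift (hyb k) i s) q < d0 /\ pdist (shift (hyb k) i s) q < d1.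
    move=> hs; apply: near => j; rewrite /shift /basis.
    case: (j =P i) => [->|_]; last by rewrite Rmult_0_r Rplus_0_r; apply: hybB.
    have -> : hyb k i = z i by rewrite /hyb ltnn.
    move: hs; rewrite /Rmin /Rmax.
    by case: (Rle_dec 0 _); case: (Rle_dec (y i) _) => ? ? ?; lra.
  have [s [/nears [_ sd] E]] := partial_mean_value f (D i) i (hyb k) (y i - z i)
    (fun s hs => Df _ (proj1 (nears s hs)) i).
  rewrite hS S_INR.
  have -> : (fun j => shift (hyb k) i (y i - z i) j - z j) =
     (fun j => 1 * (hyb k j - z j) + (y i - z i) * basis i j).
    by apply: functional_extensionality => j; rewrite /shift; ring.
  rewrite dot_lin (dotC (basis i)) dot_basis.
  set A := dot _ _ in IH *.
  have -> : f (shift (hyb k) i (y i - z i)) - f z - (1 * A + (y i - z i) * D i q) =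
    (f (hyb k) - f z - A) + (D i (shift (hyb k) i s) - D i q) * (y i - z i) by lra.
  apply: Rle_trans (Rabs_triang _ _) _; rewrite Rabs_mult.
  have := IH (ltnW km); have := H1 i _ sd; have := abs_coord_sub_le y z i.
  have := Rabs_pos (y i - z i); have := Rabs_pos (D i (shift (hyb k) i s) - D i q).
  nra.
have := step m.+1 (leqnn _).
have -> : hyb m.+1 = y.
  by apply: functional_extensionality => j; rewrite /hyb ltn_ord.
by have -> : INR m.+1 * (e * pdist y z) = eps * pdist y z by rewrite /e; field; lra.
Qed.

(** Strict differentiability controls secants both of whose ends move towards [q]: equal values at
    the ends force the derivative along the limiting direction [v] to vanish. Neither end need be
    [q], as for the secant from a point to its foot on the equator. *)
Lemma derivative_zero f (D : 'I_m.+1 -> Point m -> R) q v d0 : d0 > 0 ->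
  (forall y, pdist y q < d0 -> forall i, has_partial f i y (D i y)) ->
  (forall i eps, eps > 0 -> exists d, d > 0 /\
     forall y, pdist y q < d -> Rabs (D i y - D i q) < eps) ->
  (forall d, d > 0 -> exists y z s, [/\ s > 0, pdist y q < d, pdist z q < d, f y = f z
     & norm (fun i => (y i - z i) - s * v i) <= d * s]) ->
  dot v (fun i => D i q) = 0.
Proof.
move=> d00 Df Dc hv.
set g : Point m := fun i => D i q; set A := dot v g.
apply: NNPP => A0; have {A0} Ap : 0 < Rabs A by apply: Rabs_pos_lt.
have ? := norm_ge0 v; have ? := norm_ge0 g.
(* Per unit of [s], strict differentiability costs e (|v| + 1) and replacing the secant by [v] costs
   e |g|. The total is e (K - 1), strictly below |A| / 2. *)
set K := norm v + norm g + 2.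
have K0 : K > 0 by rewrite /K; lra.
have e0 : Rabs A / (2 * K) > 0 by apply: Rdiv_lt_0_compat; lra.
have [d [d_0 hd]] := strictly_differentiable f D q d0 d00 Df Dc _ e0.
set e := Rabs A / (2 * K) in e0 hd.
have eK : e * K = Rabs A / 2 by rewrite /e; field; lra.
set d' := Rmin d (Rmin 1 e).
have d'd : d' <= d by apply: Rmin_l.
have d'1 : d' <= 1 by apply: Rle_trans (Rmin_r _ _) (Rmin_l _ _).
have d'e : d' <= e by apply: Rle_trans (Rmin_r _ _) (Rmin_r _ _).
have d'0 : d' > 0 by apply: Rmin_pos => //; apply: Rmin_pos => //; lra.
have [y [z [s [s0 yq zq E hn]]]] := hv d' d'0.
have := hd y z ltac:(lra) ltac:(lra).
set r : Point m := fun i => _ in hn.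
have Ed : (fun i => y i - z i) = (fun i => s * v i + 1 * r i).
  by apply: functional_extensionality => i; rewrite /r; ring.
rewrite E /pdist Ed dot_lin -/A -/g => h1.
have h2 := norm_lin_le s 1 v r; rewrite Rabs_R1 (Rabs_right s) in h2; last lra.
have h3 := abs_dot_le r g.
have ? := norm_ge0 r.
have h4 : Rabs (s * A) <= e * norm (fun i => s * v i + 1 * r i) + norm r * norm g.
  have -> : s * A = - (f z - f z - (s * A + 1 * dot r g)) - dot r g by ring.
  have := Rabs_triang (- (f z - f z - (s * A + 1 * dot r g))) (- dot r g).
  rewrite !Rabs_Ropp /Rminus; rewrite /Rminus in h1; lra.
rewrite Rabs_mult (Rabs_right s) in h4; last lra.
have : s * Rabs A <= s * (e * K - e).
  apply: Rle_trans h4 _.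
  have : norm r * norm g <= (e * s) * norm g by apply: Rmult_le_compat_r => //; nra.
  have : norm (fun i => s * v i + 1 * r i) <= s * (norm v + 1) by nra.
  rewrite /K; nra.
nra.
Qed.

End Calculus.

(** * Sequential compactness of the sphere *)

(** The indices need not increase: [n <= psi n] and the rate [/ (INR n + 1)] are what survives when
    extractions are composed coordinate by coordinate. *)
Lemma bounded_seq_adherent (v : nat -> R) : (forall n, Rabs (v n) <= 1) ->
  exists (psi : nat -> nat) l, forall n,
    (n <= psi n)%N /\ Rabs (v (psi n) - l) < / (INR n + 1).
Proof.
move=> v1.
have [l hl] := Bolzano_Weierstrass v (fun c => -1 <= c <= 1) (compact_P3 (-1) 1)
  (fun n => ltac:(by have := Rle_abs (v n); have := Rle_abs (- v n); have := v1 n;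
                     rewrite Rabs_Ropp; lra)).
have /functional_choice [psi hpsi] : forall n, exists p, (n <= p)%N /\ Rabs (v p - l) < / (INR n + 1).
  move=> n; have n0 : 0 < / (INR n + 1) by apply: Rinv_0_lt_compat; have := pos_INR n; lra.
  have [p [/leP np hp]] := hl (disc l (mkposreal _ n0)) n
     (ex_intro _ (mkposreal _ n0) (fun _ h => h)).
  by exists p.
by exists psi, l.
Qed.

Lemma sphere_adherent m (u : nat -> Point m) : (forall n, in_sphere (u n)) ->
  exists q, in_sphere q /\
    forall eps N, eps > 0 -> exists n, (N <= n)%N /\ pdist (u n) q < eps.
Proof.
move=> us.
have rate p n : (n <= p)%N -> / (INR p + 1) <= / (INR n + 1).
  move=> /leP /le_INR np; apply: Rinv_le_contravar; have := pos_INR n; lra.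
have ex k : (k <= m.+1)%N -> exists (phi : nat -> nat) (q : Point m), forall n,
    (n <= phi n)%N /\
    forall i : 'I_m.+1, (i < k)%N -> Rabs (u (phi n) i - q i) < / (INR n + 1).
  elim: k => [|k IH] km.
    by exists id, (fun _ => 0) => n; split.
  have [phi [q hq]] := IH (ltnW km).
  pose i := Ordinal km.
  have [psi [l hl]] := bounded_seq_adherent (fun n => u (phi n) i)
    (fun n => ltac:(by rewrite -(norm_sphere _ (us (phi n))); apply: abs_coord_le)).
  exists (fun n => phi (psi n)), (fun j => if j == i then l else q j) => n.
  have [np ln] := hl n; have [pp qn] := hq (psi n).
  split; first exact: leq_trans np pp.
  move=> j; rewrite ltnS leq_eqVlt.
  case: (j =P i) => [->|ne] //.
  case/orP => [/eqP E|jk]; first by case: ne; apply: val_inj.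
  by apply: Rlt_le_trans (qn j jk) (rate _ _ np).
have [phi [q hq]] := ex _ (leqnn m.+1).
have cl eps N : eps > 0 -> exists n, (N <= n)%N /\ pdist (u n) q < eps.
  move=> eps0; have m1 : 0 < INR m.+1 by apply: lt_0_INR; apply/ltP.
  have [N1 [hN1 /lt_0_INR N10]] := archimed_cor1 (eps / INR m.+1) (Rdiv_lt_0_compat _ _ eps0 m1).
  pose n := maxn N1 N; exists (phi n); have [nn hn] := hq n.
  split; first by apply: leq_trans nn; apply: leq_maxr.
  have N1n : INR N1 <= INR n by apply: le_INR; apply/leP; apply: leq_maxl.
  apply: Rle_lt_trans (norm_le_coord (fun i => u (phi n) i - q i) (/ (INR n + 1)) _) _.
    by move=> i; apply: Rlt_le; apply: hn; apply: ltn_ord.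
  have : / (INR n + 1) < eps / INR m.+1.
    by apply: Rle_lt_trans hN1; apply: Rinv_le_contravar => //; lra.
  move=> /(Rmult_lt_compat_l _ _ _ m1).
  by have -> : INR m.+1 * (eps / INR m.+1) = eps by field; lra.
exists q; split => //; apply: sphere_norm; apply: cond_eq => eps eps0.
have [n [_ hn]] := cl eps 0%N eps0.
rewrite -(norm_sphere _ (us n)); apply: Rle_lt_trans (abs_norm_sub_le _ _) _.
by rewrite pdistC.
Qed.

(** * The hyperboloid and the scalar inequalities behind the half-space *)

Section Hyperbolic.
Context {m : nat}.
Implicit Types x v : Point m.

(** With b = e^{-r}, the spatial part is (a - b) x + b v, of squared length (a - b)^2 + b^2 |v|^2 by
    orthogonality. Since 2ab = 1 + b^2 (1 + |v|^2), subtracting a^2 leaves -1. *)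
Lemma phi_map_hyperbolic r v x : in_sphere x -> dot x v = 0 ->
  in_hyperbolic (phi_map r v x).
Proof.
move=> x1 xv; rewrite /in_hyperbolic /lorentz /phi_map /=.
set a := exp r / 2 * _.
have E : exp r * exp (- r) = 1 by rewrite -exp_plus Rplus_opp_r exp_0.
have E2 : exp (-2 * r) = exp (- r) * exp (- r).
  by rewrite -exp_plus; congr exp; ring.
have ? := exp_pos r; have ? := exp_pos (- r); have ? := dot_ge0 v.
split; last first.
  rewrite /a E2; apply: Rmult_lt_0_compat; first lra.
  have : 0 < exp (- r) * exp (- r) * (1 + dot v v) by nra.
  lra.
have -> : (fun i => a * x i + exp (- r) * (- x i + v i)) =
          (fun i => (a - exp (- r)) * x i + exp (- r) * v i).
  by apply: functional_extensionality => i; ring.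
rewrite dot_self_lin xv x1.
have -> : a = (exp r + exp (- r) * (exp r * exp (- r)) * (1 + dot v v)) / 2.
  by rewrite /a E2; field.
rewrite E.
have : exp (- r) * exp r = 1 by lra.
nra.
Qed.

Lemma phi_map_height rho t v x c :
  0 <= x ord_max * (exp (rho + 2 * t) / 2 + exp (- rho) * (dot v v - 1) / 2)
       + (exp (- rho) * v ord_max + c) ->
  lorentz (phi_map (rho + t) v x) (0, north m) >= - exp (- t) * c.
Proof.
move=> h; rewrite /lorentz /phi_map /= /north dot_basis.
have t0 := exp_pos (- t).
have E1 : exp (rho + t) = exp (- t) * exp (rho + 2 * t).
  by rewrite -exp_plus; congr exp; ring.
have E2 : exp (- (rho + t)) = exp (- t) * exp (- rho).
  by rewrite -exp_plus; congr exp; ring.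
have E3 : exp (rho + t) * exp (-2 * (rho + t)) = exp (- t) * exp (- rho).
  by rewrite -!exp_plus; congr exp; ring.
have -> : exp (rho + t) / 2 * (1 + exp (-2 * (rho + t)) * (1 + dot v v)) =
  exp (rho + t) / 2 + (exp (rho + t) * exp (-2 * (rho + t))) * (1 + dot v v) / 2 by field.
rewrite E3 E2 E1.
have := Rmult_le_compat_l _ _ _ (Rlt_le _ _ t0) h; lra.
Qed.

End Hyperbolic.

Lemma exp_opp_le r B : Rabs r <= B -> exp (- r) <= exp B.
Proof.
move=> rB; have [lt|->] : - r < B \/ - r = B.
- by have := Rle_abs (- r); rewrite Rabs_Ropp; lra.
- by apply: Rlt_le; apply: exp_increasing.
- lra.
Qed.

(** As [f] is bounded below by a multiple of [h], the factor [h] divides out and [T] does not depend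
    on the height. Its value comes from 1 + u <= e^u at u = r + 2t, together with e^{-r} <= e^B. *)
Lemma height_nonneg_bounded B C : exists T, forall t r V h f, t > T -> Rabs r <= B ->
  0 <= V -> 0 < h -> - C * h <= f ->
  0 <= h * (exp (r + 2 * t) / 2 + exp (- r) * (V - 1) / 2) + f.
Proof.
exists ((2 * C + exp B + B) / 2) => t r V h f tT rB V0 h0 fC.
have e1 : 1 + (r + 2 * t) <= exp (r + 2 * t) by apply: exp_ineq1_le.
have ? := exp_pos (- r).
have e2 := exp_opp_le _ _ rB.
have rB' : - r <= B by have := Rle_abs (- r); rewrite Rabs_Ropp; lra.
suff : C <= exp (r + 2 * t) / 2 + exp (- r) * (V - 1) / 2 by nra.
have : 0 <= exp (- r) * V by nra.
lra.
Qed.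

Lemma height_nonneg_blowup d c : d > 0 -> exists M, forall t r V h v, t > 0 -> d <= h ->
  v * v <= V -> exp (2 * r) + V > M ->
  0 <= h * (exp (r + 2 * t) / 2 + exp (- r) * (V - 1) / 2) + (exp (- r) * v + c).
Proof.
(* This is the value for which d (E^2 + V) / 4, what the two AM-GM estimates leave, pays for d / 2 +
   (1 + c^2) / d. *)
move=> d0; exists (2 + 4 * (1 + c * c) / (d * d)) => t r V h v t0 dh vV big.
set E := exp r; have E0 : 0 < E by apply: exp_pos.
have E2 : exp (2 * r) = E * E by rewrite -exp_plus; congr exp; ring.
have Er : exp (- r) = / E by apply: exp_Ropp.
have iE := Rinv_0_lt_compat _ E0.
set s := exp (2 * t); have s1 : 1 < s by rewrite -exp_0; apply: exp_increasing; lra.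
have -> : exp (r + 2 * t) = E * s by rewrite -exp_plus.
rewrite E2 in big; rewrite Er.
suff key : 0 <= h * (E * E * s + V - 1) / 2 + v + c * E.
  have -> : h * (E * s / 2 + / E * (V - 1) / 2) + (/ E * v + c) =
    / E * (h * (E * E * s + V - 1) / 2 + v + c * E) by field; lra.
  nra.
have dd : 0 < d * d by nra.
have q0 : 0 <= (1 + c * c) / (d * d) by apply: Rlt_le; apply: Rdiv_lt_0_compat; nra.
have big1 : E * E + V > 2 by lra.
have l1 : d * (E * E + V - 1) <= h * (E * E * s + V - 1).
  have : E * E <= E * E * s by nra.
  nra.
(* AM-GM: [|v| <= d V / 4 + 1 / d] and [|c E| <= d E^2 / 4 + c^2 / d] *)
have l2 : - v <= d * V / 4 + / d.
  have : 0 <= / d * ((d * v / 2 + 1) * (d * v / 2 + 1)).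
    by apply: Rmult_le_pos; [apply: Rlt_le; apply: Rinv_0_lt_compat | apply: Rle_0_sqr].
  have -> : / d * ((d * v / 2 + 1) * (d * v / 2 + 1)) = d * (v * v) / 4 + v + / d by field; lra.
  nra.
have l3 : - (c * E) <= d * (E * E) / 4 + c * c / d.
  have : 0 <= / d * ((d * E / 2 + c) * (d * E / 2 + c)).
    by apply: Rmult_le_pos; [apply: Rlt_le; apply: Rinv_0_lt_compat | apply: Rle_0_sqr].
  have -> : / d * ((d * E / 2 + c) * (d * E / 2 + c)) =
    d * (E * E) / 4 + c * E + c * c / d by field; lra.
  lra.
have : d * (E * E + V) >= d * (2 + 4 * (1 + c * c) / (d * d)) by nra.
have -> : d * (2 + 4 * (1 + c * c) / (d * d)) = 2 * d + 4 * (/ d + c * c / d) by field; lra.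
lra.
Qed.

(** * Cones and gradients of 0-homogeneous extensions *)

Section Cone.
Context {m : nat}.
Implicit Types (A O : Point m -> Prop) (x y q : Point m).

Lemma cone_sphere A x : in_sphere x -> A x -> cone A x.
Proof.
by move=> xs Ax; split; rewrite ?normalize_sphere // norm_sphere //; lra.
Qed.

Lemma cone_scale A y a : 0 < a -> cone A y -> cone A (fun i => a * y i).
Proof.
move=> a0 [y0 Ay]; split; last by rewrite normalize_scale.
by rewrite norm_scale Rabs_right; nra.
Qed.

Lemma cone_open O y : sphere_open O -> cone O y ->
  exists d, d > 0 /\ forall z, pdist z y < d -> cone O z.
Proof.
move=> hO [y0 Oy]; have [_ [e [e0 he]]] := hO _ Oy.
(* The first radius keeps [z] off the origin; the second compensates the factor 2 / |y| of
   [normalize_lipschitz]. *)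
exists (Rmin (norm y) (e * norm y / 2)); split.
  by apply: Rmin_pos => //; nra.
move=> z zy.
have zy1 := Rlt_le_trans _ _ _ zy (Rmin_l _ _).
have zy2 := Rlt_le_trans _ _ _ zy (Rmin_r _ _).
have z0 : 0 < norm z.
  by have := abs_norm_sub_le y z; have := Rle_abs (norm y - norm z); rewrite pdistC; lra.
split=> //; apply: he; first exact: in_sphere_normalize.
apply: Rle_lt_trans (normalize_lipschitz _ _ z0 y0) _.
apply: (Rmult_lt_reg_r (norm y)) => //.
have -> : 2 * pdist z y / norm y * norm y = 2 * pdist z y by field; lra.
lra.
Qed.

Lemma cont_on_bounded A f q : cont_on A f -> A q ->
  exists d B, d > 0 /\ forall y, A y -> pdist y q < d -> Rabs (f y) <= B.
Proof.
move=> fc Aq; have [d [d0 h]] := fc q Aq 1 Rlt_0_1.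
exists d, (Rabs (f q) + 1); split=> // y Ay yq.
have := h y Ay yq; have := Rabs_triang (f y - f q) (f q).
have -> : f y - f q + f q = f y by ring.
lra.
Qed.

Section Extension.
Variables (O : Point m -> Prop) (rho : Point m -> R) (G : 'I_m.+1 -> Point m -> R).
Hypothesis hO : sphere_open O.
Hypothesis dG : forall y, cone O y -> forall i,
  has_partial (fun z => rho (normalize z)) i y (G i y).

(** The dilation by [a] leaves the extension unchanged, so the chain rule makes its gradient
    homogeneous of degree -1. *)
Lemma gradient_homogeneous a y i : 0 < a -> cone O y ->
  a * G i (fun j => a * y j) = G i y.
Proof.
move=> a0 Oy.
apply: (has_partial_unique (fun z => rho (normalize z)) i y); last exact: dG.
have h := dG _ (cone_scale _ _ _ a0 Oy) i.
have la : derivable_pt_lim (fun s => a * s) 0 a.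
  have := derivable_pt_lim_scal id a 0 1 (derivable_pt_lim_id 0).
  by rewrite Rmult_1_r.
rewrite /has_partial -[X in derivable_pt_lim _ X](Rmult_0_r a) in h.
have := derivable_pt_lim_comp _ _ _ _ _ la h.
rewrite /comp Rmult_comm /has_partial.
apply: derivable_pt_lim_ext => s.
rewrite -(normalize_scale a (fun j => y j + s * basis i j)) //.
by congr (rho (normalize _)); apply: functional_extensionality => j; ring.
Qed.

(** Euler's relation: the extension is constant along the ray through [x], so radial secants have
    equal values at their ends. *)
Lemma gradient_tangent x :
  (forall i, cont_on (cone O) (G i)) -> O x -> dot x (vec_of G x) = 0.
Proof.
move=> Gc Ox; have [xs _] := hO _ Ox.
have Cx := cone_sphere _ _ xs Ox.
have [d0 [d00 hd]] := cone_open _ _ hO Cx.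
apply: (derivative_zero (fun z => rho (normalize z)) G x x d0 d00).
- by move=> y /hd; apply: dG.
- move=> i eps eps0; have [d [dp h]] := Gc i x Cx eps eps0.
  exists (Rmin d d0); split; first exact: Rmin_pos.
  move=> y yx; apply: h.
    by apply: hd; apply: Rlt_le_trans yx (Rmin_r _ _).
  by apply: Rlt_le_trans yx (Rmin_l _ _).
move=> d dp; exists (fun i => (1 + d / 2) * x i), x, (d / 2); split.
- lra.
- rewrite /pdist.
  have -> : (fun i => (1 + d / 2) * x i - x i) = (fun i => (d / 2) * x i).
    by apply: functional_extensionality => i; ring.
  by rewrite norm_scale norm_sphere // Rabs_right; lra.
- by rewrite pdistxx.
- by rewrite normalize_scale //; lra.
- have -> : (fun i => (1 + d / 2) * x i - x i - d / 2 * x i) = (fun i => 0 * x i).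
    by apply: functional_extensionality => i; ring.
  by rewrite norm_scale Rabs_R0; nra.
Qed.

End Extension.

(** Meant for points of [V1], where [G] is only a continuous extension and no longer a derivative:
    orthogonality is inherited as a limit from [O]. *)
Lemma gradient_tangent_closure A O (G : 'I_m.+1 -> Point m -> R) q :
  (forall i, cont_on (cone A) (G i)) ->
  (forall x, O x -> A x /\ in_sphere x) ->
  (forall x, O x -> dot x (vec_of G x) = 0) ->
  in_sphere q -> A q -> (forall eps, eps > 0 -> exists x, O x /\ pdist x q < eps) ->
  dot q (vec_of G q) = 0.
Proof.
move=> Gc OA tg qs Aq ad.
have m1 : 0 < INR m.+1 by apply: lt_0_INR; apply/ltP.
set g := vec_of G q.
have g0 := norm_ge0 g.
have K0 : 0 < INR m.+1 * 2 + norm g by lra.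
apply: cond_eq => eps eps0; rewrite Rminus_0_r.
set e := Rmin 1 (eps / 2 / (INR m.+1 * 2 + norm g)).
have e0 : e > 0.
  by apply: Rmin_pos; [lra | apply: Rdiv_lt_0_compat; lra].
have e1 : e <= 1 by apply: Rmin_l.
have eK : e * (INR m.+1 * 2 + norm g) <= eps / 2.
  have -> : eps / 2 = eps / 2 / (INR m.+1 * 2 + norm g) * (INR m.+1 * 2 + norm g) by field; lra.
  by apply: Rmult_le_compat_r; [lra | apply: Rmin_r].
have [d [d0 hd]] := common_radius _
  (fun i d => forall y, cone A y -> pdist y q < d -> Rabs (G i y - G i q) < e)
  (fun i d d' dd' h y Ay yd => h y Ay (Rlt_le_trans _ _ _ yd dd'))
  (fun i => Gc i q (cone_sphere _ _ qs Aq) e e0).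
have [x [Ox xq]] := ad (Rmin d e) (Rmin_pos _ _ d0 e0).
have [Ax xs] := OA _ Ox.
have xd := Rlt_le_trans _ _ _ xq (Rmin_l _ _).
have xe := Rlt_le_trans _ _ _ xq (Rmin_r _ _).
set k : Point m := fun i => G i x - G i q.
have nk : norm k <= INR m.+1 * e.
  by apply: norm_le_coord => i; apply: Rlt_le; apply: hd => //; apply: cone_sphere.
have kx := abs_dot_le k x; rewrite (norm_sphere x xs) in kx.
have xg := abs_dot_le (fun i => x i - q i) g; rewrite -/(pdist x q) in xg.
have -> : dot q g = - (dot (fun i => x i - q i) g + dot k x).
  have Eg : vec_of G x = fun i => 1 * k i + 1 * g i.
    by apply: functional_extensionality => i; rewrite /k /g /vec_of; ring.
  have := tg _ Ox; rewrite Eg dotC dot_lin (dotC g).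
  have -> : (fun i => x i - q i) = (fun i => 1 * x i + -1 * q i).
    by apply: functional_extensionality => i; ring.
  by rewrite dot_lin; lra.
rewrite Rabs_Ropp; apply: Rle_lt_trans (Rabs_triang _ _) _.
have ? := pdist_ge0 x q; nra.
Qed.

End Cone.

(** * Geometry near the equator *)

(** Let [sup] be the supremum of the parameters whose image is outside [O]. Points of [O] occur just
    after it, or at [b] itself, and points outside [O] occur at or just before it, so its image
    would be a boundary point. *)
Lemma path_avoiding_boundary m (O : Point m -> Prop) (gam : R -> Point m) a b :
  (forall s, in_sphere (gam s)) ->
  (forall s eps, eps > 0 -> exists d, d > 0 /\
     forall s', Rabs (s' - s) < d -> pdist (gam s') (gam s) < eps) ->
  (forall s, a <= s <= b -> ~ sphere_boundary O (gam s)) ->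
  a <= b -> O (gam b) -> O (gam a).
Proof.
move=> gs gc nb ab Ob; apply: NNPP => Oa.
have [sup [ub lub]] : {l | is_lub (fun s => a <= s <= b /\ ~ O (gam s)) l}.
  by apply: completeness; [exists b => s [? _]; lra | exists a; split; [lra|]].
have as_ : a <= sup by apply: ub; split; [lra|].
have sb : sup <= b by apply: lub => s [? _]; lra.
apply: (nb sup (conj as_ sb)); split=> // eps eps0.
have [d [d0 hd]] := gc sup eps eps0.
split.
- have [sb'|sb'] : sup = b \/ sup < b by lra.
    by exists (gam b); rewrite -{2}sb' pdistxx; split; [|lra].
  have h1 := Rmin_l (sup + d / 2) b; have h2 := Rmin_r (sup + d / 2) b.
  have h3 : sup < Rmin (sup + d / 2) b by apply: Rmin_glb_lt; lra.
  exists (gam (Rmin (sup + d / 2) b)); split; last first.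
    by apply: hd; rewrite Rabs_right; lra.
  apply: NNPP => nO.
  have le : a <= Rmin (sup + d / 2) b by lra.
  have := ub _ (conj (conj le h2) nO); lra.
- apply: NNPP => none.
  have : sup <= sup - d; last lra.
  apply: lub => s [sab nO]; apply: Rnot_lt_le => lt.
  have ss := ub s (conj sab nO).
  apply: none; exists (gam s); split=> //; split=> //; apply: hd.
  by apply: Rabs_def1; lra.
Qed.

Section Equator.
Context {m : nat}.
Implicit Types x p q : Point m.

Lemma norm_north : norm (north m) = 1.
Proof. by rewrite /norm /north dot_basis /basis eqxx sqrt_1. Qed.

Lemma dot_shift_equator p s : equator p ->
  dot (shift p ord_max s) (shift p ord_max s) = 1 + s * s.
Proof.
move=> [ps pn].
have -> : shift p ord_max s = (fun i => 1 * p i + s * basis ord_max i).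
  by apply: functional_extensionality => i; rewrite /shift; ring.
by rewrite dot_self_lin ps !dot_basis pn /basis eqxx; ring.
Qed.

Lemma norm_shift_equator_ge1 p s : equator p -> 1 <= norm (shift p ord_max s).
Proof.
move=> pe; apply: le_of_sqr; first exact: norm_ge0.
by rewrite norm_sqr dot_shift_equator //; nra.
Qed.

Lemma pdist_shift p i s s' : pdist (shift p i s) (shift p i s') = Rabs (s - s').
Proof.
rewrite /pdist /shift.
have -> : (fun j => p j + s * basis i j - (p j + s' * basis i j)) =
  (fun j => (s - s') * basis i j).
  by apply: functional_extensionality => j; ring.
by rewrite norm_scale /norm dot_basis /basis eqxx sqrt_1 Rmult_1_r.
Qed.

(** The foot [p] of the meridian through [x] is the normalized projection to the equatorial
    hyperplane; [r] is the cosine of the latitude, nonzero because the pole is excluded. *)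
Lemma equator_foot x : in_sphere x -> 0 <= x ord_max < 1 -> exists p r,
  [/\ equator p, 0 < r <= 1, r * r = 1 - x ord_max * x ord_max
    & x = fun i => r * p i + x ord_max * north m i].
Proof.
move=> xs [x0 x1]; set h := x ord_max in x0 x1 *.
pose f : Point m := fun i => 1 * x i + - h * north m i.
have ff : dot f f = 1 - h * h.
  by rewrite dot_self_lin xs /north !dot_basis /basis eqxx -/h; ring.
have f0 : 0 < dot f f by rewrite ff; nra.
have r0 : 0 < norm f by apply: sqrt_lt_R0.
have rr : norm f * norm f = 1 - h * h by rewrite norm_sqr.
exists (normalize f), (norm f); split=> //.
- split; first exact: in_sphere_normalize.
  have fn : f ord_max = 0 by rewrite /f /north /basis eqxx -/h; ring.
  by rewrite /normalize fn; field; lra.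
- by split=> //; apply: le_of_sqr; nra.
- apply: functional_extensionality => i; rewrite /normalize.
  have -> : norm f * (f i / norm f) = f i by field; lra.
  by rewrite /f; ring.
Qed.

(** From r^2 = 1 - h^2 and 0 < r <= 1 follows 1 - r <= h^2 <= h, so the displacements along [p] and
    along the north pole each cost at most [h]. *)
Lemma foot_near x p r : equator p -> 0 < r <= 1 ->
  r * r = 1 - x ord_max * x ord_max -> 0 <= x ord_max < 1 ->
  x = (fun i => r * p i + x ord_max * north m i) -> pdist x p <= 2 * x ord_max.
Proof.
set h := x ord_max => -[ps _] r1 rr h1 ->; rewrite /pdist.
have -> : (fun i => r * p i + h * north m i - p i) =
          (fun i => (r - 1) * p i + h * north m i).
  by apply: functional_extensionality => i; ring.
apply: Rle_trans (norm_lin_le _ _ _ _) _.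
rewrite norm_sphere // norm_north (Rabs_right h); last lra.
by rewrite Rabs_left1; nra.
Qed.

(** The relation is (lam_1, -lam_0), or (1, 0) when lam_0 = 0. The size is a variable with an
    equation because it will be [m.+1 - m.-1], the codimension in the ambient space of a
    hypersurface of the sphere. *)
Lemma proportional_dependent K (g : 'I_K -> Point m) (lam : 'I_K -> R) q : K = 2%N ->
  (forall j i, g j i = lam j * q i) ->
  exists a : 'I_K -> R, (exists j, a j <> 0) /\
    forall i, \big[Rplus/0]_(j < K) (a j * g j i) = 0.
Proof.
move=> K2; subst K => gl.
pose j1 : 'I_2 := lift ord0 ord0.
have [l0|l0] := classic (lam ord0 = 0).
- exists (fun j => if j == ord0 then 1 else 0); split; first by exists ord0 => /=; lra.
  by move=> i; rewrite !big_ord_recl big_ord0 /= !gl l0; ring.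
- exists (fun j => if j == ord0 then lam j1 else - lam ord0); split.
    by exists j1 => /=; lra.
  by move=> i; rewrite !big_ord_recl big_ord0 /= !gl -/j1; ring.
Qed.

(* Otherwise both defining functions of V near q would have vanishing derivatives
   along the equator and, by a limit of secants, along e_{m+1}: their gradients at q
   would both be multiples of q. *)
Lemma hypersurface_near_equator (V : Point m -> Prop) q : (1 <= m)%N ->
  submanifold m.-1 V -> (forall x, equator x -> V x) ->
  (forall x, V x -> in_sphere x /\ 0 <= x ord_max) -> equator q ->
  exists d, d > 0 /\ forall x, V x -> pdist x q < d -> x ord_max = 0.
Proof.
move=> m1 [_ sub] eqV Vup qe; have [qs qn] := qe.
apply: NNPP => none.
have acc d : d > 0 -> exists x, [/\ V x, pdist x q < d & 0 < x ord_max].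
  move=> d0; apply: NNPP => no; apply: none; exists d; split=> // x Vx xq.
  apply: NNPP => xn; apply: no; exists x; split=> //.
  by have [_] := Vup x Vx; lra.
have [U [oU [Uq [F [DF [smF [pF [VF indep]]]]]]]] := sub q (eqV q qe).
have [d0 [d00 ball]] := oU q Uq.
have F0 x : V x -> pdist x q < d0 -> forall j, F j x = 0.
  by move=> Vx /ball Ux; apply/VF.
have dz j v : (forall d, d > 0 -> d <= d0 -> d <= 1 -> exists y z s, [/\ s > 0,
     V y /\ pdist y q < d, V z /\ pdist z q < d
     & norm (fun i => (y i - z i) - s * v i) <= d * s]) ->
    dot v (fun i => DF j i q) = 0.
  move=> hv.
  apply: (derivative_zero (F j) (DF j) q v d0 d00).
  - by move=> y /ball Uy i; apply: pF.
  - move=> i eps eps0; have [D [Dp Dc]] := smF j 1%N.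
    have ED y : U y -> DF j i y = D i y.
      by move=> Uy; apply: (has_partial_unique (F j) i y); [apply: pF | apply: Dp].
    have [d [dp h]] := Dc i q Uq eps eps0.
    exists (Rmin d d0); split; first exact: Rmin_pos.
    move=> y yq; have Uy := ball y (Rlt_le_trans _ _ _ yq (Rmin_r _ _)).
    rewrite !ED //; apply: h => //; exact: Rlt_le_trans yq (Rmin_l _ _).
  move=> d dp; set e := Rmin d (Rmin d0 1).
  have ed : e <= d by apply: Rmin_l.
  have ed0 : e <= d0 by apply: Rle_trans (Rmin_r _ _) (Rmin_l _ _).
  have e1 : e <= 1 by apply: Rle_trans (Rmin_r _ _) (Rmin_r _ _).
  have e0 : e > 0 by apply: Rmin_pos => //; apply: Rmin_pos => //; lra.
  have [y [z [s [s0 [Vy yq] [Vz zq] hn]]]] := hv e e0 ed0 e1.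
  exists y, z, s; split=> //; try lra; last nra.
  by rewrite !F0 //; lra.
have vert j : dot (north m) (fun i => DF j i q) = 0.
  apply: dz => d dp dd0 d1.
  (* The secant joins [x] to its foot [p]. As the height h of [x] is at most |x - q| and |x - p| <=
     2h, a third of [d] keeps [p] within [d] of [q]; the deviation from the vertical is 1 - r <= h^2
     <= d h. *)
  have [x [Vx xq x0]] := acc (d / 3) ltac:(lra).
  have [xs _] := Vup x Vx.
  have xle : x ord_max <= pdist x q.
    by have := abs_coord_sub_le x q ord_max; rewrite qn Rminus_0_r Rabs_right; lra.
  have [p [r [pe r1 rr E]]] := equator_foot x xs ltac:(lra).
  have xp := foot_near x p r pe r1 rr ltac:(lra) E.
  exists x, p, (x ord_max); split=> //; first by split=> //; lra.
    split; first exact: eqV.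
    by have := pdist_triangle x p q; rewrite (pdistC p x); lra.
  have -> : (fun i => x i - p i - x ord_max * north m i) = (fun i => (r - 1) * p i).
    by apply: functional_extensionality => i; rewrite {1}E; ring.
  rewrite norm_scale norm_sphere; last by case: pe.
  by rewrite Rabs_left1; nra.
have horiz j v : dot q v = 0 -> v ord_max = 0 -> dot v (fun i => DF j i q) = 0.
  move=> qv vn; apply: dz => d dp dd0 d1.
  set T := dot v v; have T0 : 0 <= T by apply: dot_ge0.
  have nv := norm_ge0 v.
  (* Dividing by [4 * K] makes [s], [s * T] and [s * norm v] all at most [d / 4], which bounds both
     |y - q| and the deviation of the secant from [v]. *)
  set K := T + norm v + 1; have K0 : K > 0 by rewrite /K; lra.
  set s := d / (4 * K).
  have s0 : s > 0 by apply: Rdiv_lt_0_compat; lra.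
  have sK : s * K = d / 4 by rewrite /s; field; lra.
  have ssT : 0 <= s * s * T by apply: Rmult_le_pos => //; nra.
  have D0 : 1 + s * s * T > 0 by lra.
  set sg := 2 * s / (1 + s * s * T).
  have sg0 : sg > 0 by apply: Rdiv_lt_0_compat; lra.
  have sgs : sg <= 2 * s.
    have -> : 2 * s = sg * (1 + s * s * T) by rewrite /sg; field; lra.
    nra.
  (* stereographic parametrisation of the great circle through q with direction v *)
  pose y : Point m := fun i => ((1 - s * s * T) / (1 + s * s * T)) * q i + sg * v i.
  have ye : equator y.
    split; last by rewrite /y qn vn; ring.
    by rewrite /in_sphere dot_self_lin qs qv -/T /sg; field; lra.
  have yqE : (fun i => y i - q i) = (fun i => (- (sg * (s * T))) * q i + sg * v i).
    by apply: functional_extensionality => i; rewrite /y /sg; field; lra.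
  have sT : s * T <= d / 4 by rewrite -sK /K; nra.
  have sv : s * norm v <= d / 4 by rewrite -sK /K; nra.
  have s4 : s <= d / 4 by rewrite -sK /K; nra.
  exists y, q, sg; split=> //.
  - split; first exact: eqV.
    rewrite /pdist yqE; apply: Rle_lt_trans (norm_lin_le _ _ _ _) _.
    by rewrite Rabs_Ropp norm_sphere // !Rabs_right; nra.
  - by split; [apply: eqV | rewrite pdistxx].
  have -> : (fun i => y i - q i - sg * v i) = (fun i => (- (sg * (s * T))) * q i).
    apply: functional_extensionality => i; have := f_equal (fun f => f i) yqE => /= ->; ring.
  rewrite norm_scale norm_sphere // Rabs_Ropp Rabs_right; nra.
(* For [i] other than [ord_max], the vector e_i - q_i q is tangent to the equator at [q], so [horiz]
   applies to it; at [ord_max] both sides vanish. *)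
have prop j i : DF j i q = dot q (fun i => DF j i q) * q i.
  have [->|/eqP ne] := eqVneq i ord_max.
    by have := vert j; rewrite dotC /north dot_basis qn => ->; ring.
  have : dot (fun k => 1 * basis i k + - q i * q k) (fun i => DF j i q) = 0.
    apply: horiz.
      by rewrite dotC dot_lin dotC dot_basis qs; ring.
    rewrite qn /basis; case: eqP => [E|_]; last ring.
    by case: ne.
  by rewrite dot_lin (dotC (basis i)) dot_basis; lra.
have K2 : (m.+1 - m.-1 = 2)%N by rewrite -{1}(prednK m1) subSn ?subSnn //; apply: leqW.
have [a [[j aj] az]] := proportional_dependent _ (fun j i => DF j i q) _ q K2 prop.
by apply: aj; apply: (indep q Uq (eqV q qe) a az).
Qed.

End Equator.

(** * Consequences of the curvature condition near the equator *)

Lemma pdist_normalize_sphere m (w q : Point m) : in_sphere q -> 1 <= norm w ->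
  pdist (normalize w) q <= 2 * pdist w q.
Proof.
move=> qs w1; rewrite -{1}(normalize_sphere _ qs).
have := normalize_lipschitz w q; rewrite (norm_sphere q qs) Rdiv_1_r; apply; lra.
Qed.

(* Over a point p of the equator, s |-> e^{-rho} G_{m+1} at p + s e_{m+1} has a bounded
   derivative and value -c at s = 0; by homogeneity of G, at the point of this ray
   over x it equals r e^{-rho(x)} G_{m+1}(x), with r = sqrt (1 - x_{m+1}^2). *)
Lemma equator_estimate m (O V : Point m -> Prop) c (rho : Point m -> R)
    (G : 'I_m.+1 -> Point m -> R) (Hn : Point m -> R) q d0 :
  let A := fun x => O x \/ V x in
  sphere_open O -> (forall x, O x -> upper_hemisphere x) ->
  (forall y, cone O y -> forall i, has_partial (fun z => rho (normalize z)) i y (G i y)) ->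
  (forall y, cone O y -> has_partial (G ord_max) ord_max y (Hn y)) ->
  cont_on (cone A) (fun z => rho (normalize z)) ->
  cont_on (cone A) (G ord_max) -> cont_on (cone A) Hn ->
  (forall x, equator x -> V x) ->
  (forall x, equator x -> mean_curv_equator rho G x = c) ->
  equator q -> d0 > 0 ->
  (forall z, sphere_boundary O z -> pdist z q < d0 -> z ord_max = 0) ->
  exists d B C, d > 0 /\ forall x, O x -> pdist x q < d ->
    Rabs (rho x) <= B /\ - C * x ord_max <= exp (- rho x) * G ord_max x + c.
Proof.
move=> A hO hup dG dH rc Gc Hc eqV mc qe d00 hb.
have [qs qn] := qe.
have Aq : cone A q by apply: cone_sphere => //; right; apply: eqV.
have [d1 [B1 [d10 hB1]]] := cont_on_bounded _ _ _ rc Aq.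
have [d2 [B2 [d20 hB2]]] := cont_on_bounded _ _ _ Gc Aq.
have [d3 [B3 [d30 hB3]]] := cont_on_bounded _ _ _ Hc Aq.
pose D := Rmin (Rmin d0 d1) (Rmin (Rmin d2 d3) 1).
have D0 : D > 0 by do !apply: Rmin_pos => //; lra.
have Dd0 : D <= d0 by apply: Rle_trans (Rmin_l _ _) (Rmin_l _ _).
have Dd1 : D <= d1 by apply: Rle_trans (Rmin_l _ _) (Rmin_r _ _).
have Dd2 : D <= d2.
  by apply: Rle_trans (Rmin_r _ _) (Rle_trans _ _ _ (Rmin_l _ _) (Rmin_l _ _)).
have Dd3 : D <= d3.
  by apply: Rle_trans (Rmin_r _ _) (Rle_trans _ _ _ (Rmin_l _ _) (Rmin_r _ _)).
have D1 : D <= 1 by apply: Rle_trans (Rmin_r _ _) (Rmin_r _ _).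
pose C1 := exp B1 * (B3 + B2 * B2).
(* With |x - q| < D/16, the segment has length T <= 2h and its foot is within 2h of [x], so it stays
   within 5D/16 of [q]; normalizing at most doubles this. In the last constant, [2 * C1] comes from
   T <= 2h and [exp B1 * B2] from replacing r u by u, since 1 - r <= h. *)
exists (D / 16), B1, (2 * C1 + exp B1 * B2); split; first lra.
move=> x Ox xq.
have [xs x0] := hup x Ox; set h := x ord_max in x0 *.
have hq : h <= pdist x q.
  by have := abs_coord_sub_le x q ord_max; rewrite qn Rminus_0_r Rabs_right -/h; lra.
have Cx : cone A x by apply: cone_sphere => //; left.
have rx : Rabs (rho x) <= B1.
  by rewrite -{1}(normalize_sphere x xs); apply: hB1 => //; lra.
have gx : Rabs (G ord_max x) <= B2 by apply: hB2 => //; lra.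
split=> //.
have [p [r [pe r1 rr Ex]]] := equator_foot x xs ltac:(rewrite -/h; lra).
rewrite -/h in rr Ex.
have xp := foot_near x p r pe r1 rr ltac:(rewrite -/h; lra) Ex; rewrite -/h in xp.
have rh : / 2 <= r by nra.
pose T := h / r.
have T0 : 0 < T by apply: Rdiv_lt_0_compat; lra.
have rT : r * T = h by rewrite /T; field; lra.
have T2 : T <= 2 * h by nra.
pose w s := shift p ord_max s.
have w1 s : 1 <= norm (w s) by apply: norm_shift_equator_ge1.
have w0 : w 0 = p by apply: shift0.
have wx : (fun i => r * w T i) = x.
  apply: functional_extensionality => i; rewrite /w /shift {1}Ex -rT /north; ring.
have nwT : normalize (w T) = x.
  by rewrite -(normalize_scale r) ?wx ?normalize_sphere //; lra.
have wq s : 0 <= s <= T -> pdist (w s) q < 5 * (D / 16).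
  move=> s0.
  have := pdist_triangle (w 0) (w s) q.
  have -> : pdist (w s) (w 0) = s by rewrite pdist_shift Rminus_0_r Rabs_right; lra.
  by have := pdist_triangle x p q; rewrite w0 (pdistC p x); lra.
have nwq s : 0 <= s <= T -> pdist (normalize (w s)) q < D.
  by move=> /wq ?; have := pdist_normalize_sphere m (w s) q qs (w1 s); lra.
(* The segment projects to the meridian from [p] to [x]. Boundary points near [q] have height zero
   while this path has positive height for positive parameters, so it cannot leave [O] when followed
   back from [x]. *)
have Ow s : 0 < s <= T -> cone O (w s).
  move=> s0; split; first by have := w1 s; lra.
  apply: (path_avoiding_boundary m O (fun s => normalize (w s)) s T); try lra.
  - by move=> s'; apply: in_sphere_normalize; have := w1 s'; lra.
  - move=> s1 eps eps0; exists (eps / 2); split; first lra.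
    move=> s2 s12; have w1' := w1 s1; have w2' := w1 s2.
    apply: Rle_lt_trans (normalize_lipschitz _ _ _ _) _; try lra.
    rewrite /w pdist_shift -/(w s1); apply: (Rmult_lt_reg_r (norm (w s1))); first lra.
    have -> : 2 * Rabs (s2 - s1) / norm (w s1) * norm (w s1) = 2 * Rabs (s2 - s1).
      by field; lra.
    nra.
  - move=> s1 s1T bd.
    have := hb _ bd ltac:(have := nwq s1; lra).
    have [_ pn] := pe; rewrite /normalize {1}/w /shift pn /basis eqxx.
    have := w1 s1 => w1'.
    suff : 0 < (0 + s1 * 1) / norm (w s1) by lra.
    by apply: Rdiv_lt_0_compat; lra.
  - by rewrite nwT.
have Aw s : 0 <= s <= T -> cone A (w s).
  move=> s0; have [->|sp] : s = 0 \/ 0 < s by lra.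
    by rewrite w0; apply: cone_sphere; [case: pe | right; apply: eqV].
  by have [? ?] := Ow s ltac:(lra); split=> //; left.
pose k s := exp (- rho (normalize (w s))).
pose g s := k s * G ord_max (w s).
have kB s : 0 <= s <= T -> 0 < k s <= exp B1.
  move=> s0; split; first exact: exp_pos.
  by apply: exp_opp_le; apply: hB1; [apply: Aw | have := wq s s0; lra].
have GB s : 0 <= s <= T -> Rabs (G ord_max (w s)) <= B2.
  by move=> s0; apply: hB2; [apply: Aw | have := wq s s0; lra].
have HB s : 0 <= s <= T -> Rabs (Hn (w s)) <= B3.
  by move=> s0; apply: hB3; [apply: Aw | have := wq s s0; lra].
pose g' s := k s * - G ord_max (w s) * G ord_max (w s) + k s * Hn (w s).
have dg s : 0 < s <= T -> derivable_pt_lim g s (g' s).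
  move=> s0; have Os := Ow s s0.
  have e1 := shift_derivable _ _ _ _ _ (dG _ Os ord_max).
  have e2 := shift_derivable _ _ _ _ _ (dH _ Os).
  have e3 := derivable_pt_lim_comp _ exp _ _ _ (derivable_pt_lim_opp _ _ _ e1)
    (derivable_pt_lim_exp _).
  exact: derivable_pt_lim_mult e3 e2.
have gB s : 0 <= s <= T -> Rabs (g' s) <= C1.
  move=> s0; have kb := kB s s0; have Gb := GB s s0; have Hb := HB s s0.
  apply: Rle_trans (Rabs_triang _ _) _; rewrite !Rabs_mult Rabs_Ropp (Rabs_right (k s)); last lra.
  have := Rabs_pos (G ord_max (w s)); have := Rabs_pos (Hn (w s)) => ? ?.
  have gg : Rabs (G ord_max (w s)) * Rabs (G ord_max (w s)) <= B2 * B2 by nra.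
  have : k s * (Rabs (G ord_max (w s)) * Rabs (G ord_max (w s)) + Rabs (Hn (w s))) <= C1.
    by apply: Rmult_le_compat; try lra; nra.
  lra.
have C10 : 0 <= C1 by apply: Rle_trans (Rabs_pos _) (gB 0 ltac:(lra)).
have gTs s : 0 < s < T -> Rabs (g T - g s) <= C1 * T.
  move=> s0; have [z [-> zs]] := MVT_cor2 g g' s T ltac:(lra) (fun z hz => dg z ltac:(lra)).
  rewrite Rabs_mult (Rabs_right (T - s)); last lra.
  by apply: Rmult_le_compat; [apply: Rabs_pos | lra | apply: gB; lra | lra].
(* Continuity at 0 is available only from the side of positive parameters; composing with [Rabs]
   turns it into the two-sided [continuity_pt]. *)
have ct f : cont_on (cone A) f -> continuity_pt (fun s => f (w (Rabs s))) 0.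
  move=> fc eps eps0; have [d [dp hd]] := fc (w 0) (Aw 0 ltac:(lra)) eps eps0.
  exists (Rmin d T); split; first exact: Rmin_pos.
  move=> s [_]; rewrite /= /Rdist Rminus_0_r Rabs_R0 => sd.
  have ? := Rabs_pos s.
  have sd1 := Rlt_le_trans _ _ _ sd (Rmin_l _ _).
  have sd2 := Rlt_le_trans _ _ _ sd (Rmin_r _ _).
  apply: hd; first by apply: Aw; lra.
  by rewrite pdist_shift Rminus_0_r Rabs_Rabsolu.
have cg : continuity_pt (fun s => g (Rabs s)) 0.
  apply: continuity_pt_mult (ct _ Gc).
  apply: (continuity_pt_comp _ exp).
    by apply: continuity_pt_opp; apply: (ct _ rc).
  by apply: derivable_continuous_pt; apply: derivable_pt_exp.
have g0T : Rabs (g T - g 0) <= C1 * T.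
  apply: Rnot_lt_le => lt.
  have [d [dp hd]] := cg (Rabs (g T - g 0) - C1 * T) ltac:(lra).
  pose s := Rmin d T / 2.
  have ? := Rmin_l d T; have ? := Rmin_r d T.
  have ? : 0 < Rmin d T by apply: Rmin_pos.
  have sp : 0 < s by rewrite /s; lra.
  have sd : s < d by rewrite /s; lra.
  have := hd s; rewrite /= /Rdist Rminus_0_r Rabs_R0 (Rabs_right s); last lra.
  move=> hs; have {hs} : Rabs (g s - g 0) < Rabs (g T - g 0) - C1 * T.
    by apply: hs; split=> //; split=> //; apply: Rlt_not_eq.
  have := gTs s ltac:(rewrite /s; lra).
  have := Rabs_triang (g T - g s) (g s - g 0).
  have -> : g T - g s + (g s - g 0) = g T - g 0 by ring.
  lra.
have E0 : g 0 = - c.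
  rewrite /g /k w0 normalize_sphere; last by case: pe.
  by have := mc p pe; rewrite /mean_curv_equator /north dot_basis /vec_of; lra.
have ET : g T = r * (exp (- rho x) * G ord_max x).
  rewrite /g /k nwT -(gradient_homogeneous O rho G dG r (w T) ord_max) ?wx; try lra.
  by apply: Ow; lra.
rewrite E0 ET in g0T.
set u := exp (- rho x) * G ord_max x in g0T *.
have uB : Rabs u <= exp B1 * B2.
  rewrite /u Rabs_mult Rabs_right; last by apply: Rle_ge; apply: Rlt_le; apply: exp_pos.
  apply: Rmult_le_compat => //; [by apply: Rlt_le; apply: exp_pos | by apply: Rabs_pos |].
  exact: exp_opp_le.
have u1 : - (exp B1 * B2) <= u by have := Rle_abs (- u); rewrite Rabs_Ropp; lra.
have u2 : - (C1 * T) <= r * u + c.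
  by have := Rle_abs (- (r * u - - c)); rewrite Rabs_Ropp; lra.
have EB : 0 <= exp B1 * B2 by apply: Rle_trans (Rabs_pos _) uB.
have rh' : 1 - r <= h by nra.
have : (1 - r) * u >= - (exp B1 * B2) * h by nra.
have : C1 * T <= C1 * (2 * h) by apply: Rmult_le_compat_l.
lra.
Qed.

(** * Local thresholds and their assembly by compactness *)

Theorem mainTheorem8 (m : nat) (Omega V1 V2 : Point m -> Prop) (alpha c : R)
    (rho : Point m -> R) (G : 'I_m.+1 -> Point m -> R)
    (H : 'I_m.+1 -> 'I_m.+1 -> Point m -> R) :
  (3 <= m)%nat ->
  sphere_domain Omega ->
  (forall x, Omega x -> upper_hemisphere x) ->
  (forall x, sphere_boundary Omega x <-> V1 x \/ V2 x) ->
  (forall x, V1 x -> V2 x -> False) ->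
  compact_sphere_hypersurface V1 ->
  (forall x, equator x -> V1 x) ->
  finite_union_compact_submanifolds V2 ->
  C2alpha Omega V1 alpha rho G H ->
  (forall x, equator x -> mean_curv_equator rho G x = c) ->
  (forall q, V2 q -> forall M : R, exists delta, delta > 0 /\
     forall x, (Omega x \/ V1 x) -> pdist x q < delta ->
       exp (2 * rho x) + dot (vec_of G x) (vec_of G x) > M) ->
  exists t0, t0 >= 0 /\ forall t, t > t0 -> forall x,
    (Omega x \/ (V1 x /\ ~ equator x)) ->
    let y := phi_map (rho x + t) (vec_of G x) x in
    in_hyperbolic y /\ lorentz y (0, north m) >= - exp (- t) * c.
Proof.
move=> m3 [hO _] hup bd dis [_ [_ sub1]] eqV1 _ [_ [dG [dH [rc [Gc [Hc _]]]]]] mc blow.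
set A := fun x => _ in rc Gc Hc.
have bs z : V1 z \/ V2 z -> in_sphere z /\ 0 <= z ord_max.
  move=> /bd [zs hz]; split=> //; apply: Rnot_lt_le => zn.
  have [[y [/hup [_ yn] yz]] _] := hz (- z ord_max) ltac:(lra).
  have := abs_coord_sub_le y z ord_max; have := Rle_abs (y ord_max - z ord_max); lra.
have As x : A x -> in_sphere x.
  by case=> [/hup [] //|V1x]; have [] := bs x (or_introl V1x).
have coneA x : A x -> cone A x by move=> Ax; apply: cone_sphere => //; apply: As.
have near q eps : V1 q \/ V2 q -> eps > 0 -> exists y, Omega y /\ pdist y q < eps.
  by move=> /bd [_ h] /h [].
have tangent x : A x -> dot x (vec_of G x) = 0.
  have tO y : Omega y -> dot y (vec_of G y) = 0.
    apply: (gradient_tangent Omega rho) => // i z Cz eps eps0.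
    have sub z' : cone Omega z' -> cone A z' by move=> [? ?]; split=> //; left.
    have [d [dp h]] := Gc i z (sub z Cz) eps eps0.
    by exists d; split=> // y' /sub Cy; apply: h.
  move=> Ax; have [Ox|V1x] := Ax; first exact: tO.
  apply: (gradient_tangent_closure A Omega) => //.
  - by move=> y Oy; split; [left | case: (hup y Oy)].
  - exact: As.
  - by move=> eps; apply: near; left.
have rcA q : A q -> exists d B, d > 0 /\ forall x, A x -> pdist x q < d -> Rabs (rho x) <= B.
  move=> Aq; have [d [B [d0 h]]] := cont_on_bounded _ _ _ rc (coneA q Aq).
  exists d, B; split=> // x Ax xq.
  by have := h x (coneA x Ax) xq; rewrite normalize_sphere //; apply: As.
(* A point of [V2] close to [q] would be a limit of points of [Omega] at which e^{2 rho} + |v|^2 is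
   arbitrarily large, while near [q] it is at most [exp (2 * B) + N * N]. *)
have V2far q : A q -> exists d, d > 0 /\ forall z, V2 z -> ~ pdist z q < d.
  move=> Aq; have [d1 [B [d10 hB]]] := rcA q Aq.
  have [d2 [d20 hG]] := common_radius _
    (fun i d => forall y, cone A y -> pdist y q < d -> Rabs (G i y - G i q) < 1)
    (fun i d d' dd' h y Ay yd => h y Ay (Rlt_le_trans _ _ _ yd dd'))
    (fun i => Gc i q (coneA q Aq) 1 Rlt_0_1).
  exists (Rmin d1 d2 / 2); split; first by have := Rmin_pos _ _ d10 d20; lra.
  move=> z V2z zq.
  pose N := norm (vec_of G q) + INR m.+1 * 1.
  have [d3 [d30 hM]] := blow z V2z (exp (2 * B) + N * N).
  have [y [Oy yz]] := near z (Rmin d3 (Rmin d1 d2 / 2)) (or_intror V2z)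
    ltac:(apply: Rmin_pos => //; have := Rmin_pos _ _ d10 d20; lra).
  have ? := Rmin_l d3 (Rmin d1 d2 / 2); have ? := Rmin_r d3 (Rmin d1 d2 / 2).
  have ? := Rmin_l d1 d2; have ? := Rmin_r d1 d2.
  have yq := pdist_triangle z y q.
  have Ay : A y by left.
  have := hM y Ay ltac:(lra).
  have := hB y Ay ltac:(lra) => rB.
  have : exp (2 * rho y) <= exp (2 * B).
    have [lt|->] : rho y < B \/ rho y = B by have := Rle_abs (rho y); lra.
      by apply: Rlt_le; apply: exp_increasing; lra.
    lra.
  have : norm (vec_of G y) <= N.
    have -> : norm (vec_of G y) = norm (fun i => 1 * vec_of G q i + 1 * (G i y - G i q)).
      by congr norm; apply: functional_extensionality => i; rewrite /vec_of; ring.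
    apply: Rle_trans (norm_lin_le _ _ _ _) _; rewrite Rabs_R1 /N.
    have := norm_le_coord (fun i => G i y - G i q) 1
      (fun i => Rlt_le _ _ (hG i y (coneA y Ay) ltac:(lra))).
    lra.
  rewrite -norm_sqr; have := norm_ge0 (vec_of G y); nra.
pose P t x := 0 <= x ord_max * (exp (rho x + 2 * t) / 2 +
    exp (- rho x) * (dot (vec_of G x) (vec_of G x) - 1) / 2)
    + (exp (- rho x) * vec_of G x ord_max + c).
pose adm x := Omega x \/ (V1 x /\ ~ equator x).
have admA x : adm x -> A x /\ 0 < x ord_max.
  case=> [Ox|[V1x ne]]; first by split; [left | case: (hup x Ox)].
  split; first by right.
  have [xs x0] := bs x (or_introl V1x).
  by apply: Rnot_le_lt => xn; apply: ne; split=> //; lra.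
have local q : in_sphere q -> exists d T, d > 0 /\ forall x t, adm x -> pdist x q < d ->
    t > T -> t > 0 -> P t x.
  move=> qs.
  have [[eps [eps0 far]]|acc] :=
    classic (exists eps, eps > 0 /\ forall y, Omega y -> ~ pdist y q < eps).
    (* Here [q] is away from [Omega]. No admissible point is near it either, since points of [V1]
       are limits of points of [Omega]; this is why the radius is halved. *)
    exists (eps / 2), 0; split; first lra.
    move=> x t ax xq; exfalso.
    have [y [Oy yx]] : exists y, Omega y /\ pdist y x < eps / 2.
      case: ax => [Ox|[V1x _]]; first by exists x; rewrite pdistxx; split; [|lra].
      by apply: near; [left | lra].
    by apply: (far y Oy); have := pdist_triangle x y q; lra.
  have accq eps : eps > 0 -> exists y, Omega y /\ pdist y q < eps.
    move=> eps0; apply: NNPP => no; apply: acc; exists eps; split=> // y Oy yq.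
    by apply: no; exists y.
  have [V2q|Aq] : V2 q \/ A q.
    have [Oq|nOq] := classic (Omega q); first by right; left.
    have : sphere_boundary Omega q.
      split=> // eps eps0; split; first exact: accq.
      by exists q; rewrite pdistxx; split=> //; split=> //; lra.
    by move=> /bd [V1q|V2q]; [right; right | left].
  - have [_ q0] := bs q (or_intror V2q).
    have qp : 0 < q ord_max.
      by apply: Rnot_le_lt => qn; apply: (dis q) V2q; apply: eqV1; split=> //; lra.
    have [M hM] := height_nonneg_blowup (q ord_max / 2) c ltac:(lra).
    have [d [d0 hd]] := blow q V2q M.
    exists (Rmin d (q ord_max / 2)), 0; split; first by apply: Rmin_pos; lra.
    move=> x t /admA [Ax x0] xq tT t0.
    have xd := Rlt_le_trans _ _ _ xq (Rmin_l _ _).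
    have xd' := Rlt_le_trans _ _ _ xq (Rmin_r _ _).
    apply: hM => //; last exact: hd.
      have := abs_coord_sub_le q x ord_max; have := Rle_abs (q ord_max - x ord_max).
      by rewrite (pdistC q x); lra.
    exact: sqr_coord_le.
  have [qe|nqe] := classic (equator q).
  - have [d1 [d10 h1]] := V2far q Aq.
    have [d2 [d20 h2]] := hypersurface_near_equator V1 q (ltnW (ltnW m3)) sub1 eqV1
      (fun x V1x => bs x (or_introl V1x)) qe.
    have [d [B [C [d0 hd]]]] := equator_estimate m Omega V1 c rho G (H ord_max ord_max) q
      (Rmin d1 d2) hO hup dG (fun y Oy => dH y Oy ord_max ord_max) rc (Gc _) (Hc _ _)
      eqV1 mc qe (Rmin_pos _ _ d10 d20)
      ltac:(move=> z /bd [V1z|V2z] zq; [apply: h2 => //; exact: Rlt_le_trans zq (Rmin_r _ _) |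
        by case: (h1 z V2z); exact: Rlt_le_trans zq (Rmin_l _ _)]).
    have [T hT] := height_nonneg_bounded B C.
    exists (Rmin d d2), T; split; first exact: Rmin_pos.
    move=> x t ax xq tT t0; have [_ x0] := admA x ax.
    have xd := Rlt_le_trans _ _ _ xq (Rmin_l _ _).
    have xd2 := Rlt_le_trans _ _ _ xq (Rmin_r _ _).
    (* Points of [V1] this close to [q] have height zero, so an admissible one lies in [Omega]. *)
    case: ax => [Ox|[V1x _]]; last by have := h2 x V1x xd2; lra.
    have [rB fC] := hd x Ox xd.
    by apply: hT => //; apply: dot_ge0.
  - have q0 : 0 < q ord_max.
      have [Oq|V1q] := Aq; first by case: (hup q Oq).
      have [_ q0] := bs q (or_introl V1q).
      by apply: Rnot_le_lt => qn; apply: nqe; split=> //; lra.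
    have [d1 [B1 [d10 h1]]] := rcA q Aq.
    have [d2 [B2 [d20 h2]]] := cont_on_bounded _ _ _ (Gc ord_max) (coneA q Aq).
    pose K := exp B1 * B2 + Rabs c.
    (* Heights near [q] are at least [q ord_max / 2], so this constant converts the lower bound
       [- K] into a multiple of the height. *)
    have [T hT] := height_nonneg_bounded B1 (K / (q ord_max / 2)).
    exists (Rmin (Rmin d1 d2) (q ord_max / 2)), T; split.
      by do !apply: Rmin_pos => //; lra.
    move=> x t /admA [Ax x0] xq tT t0.
    have xd1 := Rlt_le_trans _ _ _ xq (Rle_trans _ _ _ (Rmin_l _ _) (Rmin_l _ _)).
    have xd2 := Rlt_le_trans _ _ _ xq (Rle_trans _ _ _ (Rmin_l _ _) (Rmin_r _ _)).
    have xd := Rlt_le_trans _ _ _ xq (Rmin_r _ _).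
    have rB := h1 x Ax xd1; have gB := h2 x (coneA x Ax) xd2.
    apply: hT => //; first exact: dot_ge0.
    have xq2 : q ord_max / 2 <= x ord_max.
      have := abs_coord_sub_le q x ord_max; have := Rle_abs (q ord_max - x ord_max).
      by rewrite (pdistC q x); lra.
    set u := exp (- rho x) * _.
    have uB : Rabs u <= exp B1 * B2.
      rewrite /u Rabs_mult Rabs_right; last by apply: Rle_ge; apply: Rlt_le; apply: exp_pos.
      apply: Rmult_le_compat => //; [by apply: Rlt_le; apply: exp_pos | by apply: Rabs_pos |].
      exact: exp_opp_le.
    have K0 : 0 <= K by have := Rabs_pos u; have := Rabs_pos c; rewrite /K; lra.
    have uK : - K <= u + c.
      by have := Rle_abs (- u); have := Rle_abs (- c); rewrite !Rabs_Ropp /K; lra.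
    have : K / (q ord_max / 2) * (q ord_max / 2) <= K / (q ord_max / 2) * x ord_max.
      apply: Rmult_le_compat_l => //; apply: Rmult_le_pos => //.
      by apply: Rlt_le; apply: Rinv_0_lt_compat; lra.
    have -> : K / (q ord_max / 2) * (q ord_max / 2) = K by field; lra.
    lra.
(* Otherwise there are points [u n] where the inequality fails at some time above [n]. At an
   adherent point [q] of this sequence, some [u n] close to [q] has a time beyond the local
   threshold. *)
have [n hn] : exists n : nat, forall t x, t > INR n -> t > 0 -> adm x -> P t x.
  apply: NNPP => none.
  have /functional_choice [u hu] : forall n : nat, exists x, exists t,
      [/\ t > INR n, t > 0, adm x & ~ P t x].
    move=> n; apply: NNPP => no; apply: none; exists n => t x tn t0 ax.
    by apply: NNPP => nP; apply: no; exists x, t.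
  have us n : in_sphere (u n) by have [t [_ _ /admA [/As]]] := hu n.
  have [q [qs hq]] := sphere_adherent m u us.
  have [d [T [d0 hd]]] := local q qs.
  have [N NT] := INR_unbounded T.
  have [n [Nn un]] := hq d N d0.
  have [t [tn t0 ax nP]] := hu n; apply: nP; apply: hd => //.
  by have : INR N <= INR n; [apply: le_INR; apply/leP | lra].
exists (INR n); split; first by apply: Rle_ge; apply: pos_INR.
move=> t tn x ax /=; have [Ax _] := admA x ax.
split; first by apply: phi_map_hyperbolic; [apply: As | apply: tangent].
by apply: phi_map_height; apply: hn => //; have := pos_INR n; lra.
Qed.
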